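(* Let $\mathbb{X}$ be a finite filtered cell complex with injective filter map $f:\mathbb{X}\to\{1,\dots,N\}$ and let $\mathbb{A},\mathbb{B}\subseteq\mathbb{X}$ be disjoint non-empty subcomplexes. Consider the persistence modules $\operatorname{Ker}(\iota^{\mathbb{A}}_* )$, $\operatorname{Ker}(\iota^{\mathbb{B}}_* )$, $\operatorname{Ker}(\iota^{\mathbb{A}\cup\mathbb{B}}_* )$ and $\operatorname{Cok}(\Phi)$, indexed by $i\in\{0,1,\dots,N\}$. Let $t\in\{1,\dots,N\}$. (1) A class in $\operatorname{Cok}(\Phi)$ is born at time $t$ if and only if a class in $\operatorname{Ker}(\iota^{\mathbb{A}\cup\mathbb{B}}_* )$ is born at time $t$ and no class is born at time $t$ in $\operatorname{Ker}(\iota^{\mathbb{A}}_* )$ nor in $\operatorname{Ker}(\iota^{\mathbb{B}}_* )$. (2) A class in $\operatorname{Cok}(\Phi)$ dies at time $t$ if and only if one of the following holds: (a) a class is born at time $t$ in both $\operatorname{Ker}(\iota^{\mathbb{A}}_* )$ and $\operatorname{Ker}(\iota^{\mathbb{B}}_* )$ (and hence a class is also born at time $t$ in $\operatorname{Ker}(\iota^{\mathbb{A}\cup\mathbb{B}}_* )$); or (b) a class is born at time $t$ in precisely one of $\operatorname{Ker}(\iota^{\mathbb{A}}_* )$ and $\operatorname{Ker}(\iota^{\mathbb{B}}_* )$, but no class is born at time $t$ in $\operatorname{Ker}(\iota^{\mathbb{A}\cup\mathbb{B}}_* )$.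
   Context: A finite cell complex means a regular CW complex with finitely many cells (the characteristic homeomorphisms of open cells extend to the closed cells, so the boundary of each $k$-cell is a union of $(k-1)$-cells). All homology has coefficients in $\mathbb{Z}/2\mathbb{Z}$, and $H_*=\bigoplus_k H_k$. A filter map assigns to each cell $\sigma$ of $\mathbb{X}$ a number $f(\sigma)$ such that $\tau\subseteq\sigma$ (that is, $\tau$ is a face of $\sigma$) implies $f(\tau)\le f(\sigma)$. It is assumed injective with image $\{1,\dots,N\}$. Put $\mathbb{X}_i=f^{-1}((-\infty,i])$ (so $\mathbb{X}_0=\emptyset$), and $\mathbb{A}_i=\mathbb{A}\cap\mathbb{X}_i$, $\mathbb{B}_i=\mathbb{B}\cap\mathbb{X}_i$. For $\mathbb{S}\in\{\mathbb{A},\mathbb{B},\mathbb{A}\cup\mathbb{B}\}$ let $\iota^{\mathbb{S}_i}_*:H_*(\mathbb{S}_i)\to H_*(\mathbb{X}_i)$ be induced by inclusion, where $\mathbb{S}_i=\mathbb{S}\cap\mathbb{X}_i$. The persistence module $\operatorname{Ker}(\iota^{\mathbb{S}}_* )$ has $i$-th space $\operatorname{Ker}(\iota^{\mathbb{S}}_* )_i=\operatorname{Ker}(\iota^{\mathbb{S}_i}_* )$ and structure maps induced by the inclusions $\mathbb{S}_{i}\hookrightarrow\mathbb{S}_{i+1}$. Since $H_*(\mathbb{A}_i\cup\mathbb{B}_i)=H_*(\mathbb{A}_i)\oplus H_*(\mathbb{B}_i)$, there is a natural map $$\Phi_i:\operatorname{Ker}(\iota^{\mathbb{A}_i}_* )\oplus\operatorname{Ker}(\iota^{\mathbb{B}_i}_*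 )\to\operatorname{Ker}(\iota^{\mathbb{A}_i\cup\mathbb{B}_i}_* ),$$ induced by the inclusions $\mathbb{A}_i,\mathbb{B}_i\hookrightarrow\mathbb{A}_i\cup\mathbb{B}_i$. The persistence module $\operatorname{Cok}(\Phi)$ has $i$-th space $\operatorname{Cok}(\Phi)_i=\operatorname{Cok}(\Phi_i)$ with the induced structure maps. For each of these persistence modules $M$, a birth happens at time $t$ (a class is born at time $t$) if $\dim M_t=\dim M_{t-1}+1$, and a death happens at time $t$ (a class dies at time $t$) if $\dim M_t=\dim M_{t-1}-1$. *)

(* Defs.v *)
From HB Require Import structures.
From mathcomp Require Import all_boot all_order all_algebra.
From mathcomp Require Import all_classical all_reals all_analysis.
Import Order.TTheory GRing.Theory Num.Theory numFieldNormedType.Exports.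

Set Implicit Arguments.
Unset Strict Implicit.
Unset Printing Implicit Defensive.

Local Open Scope classical_set_scope.
Local Open Scope ring_scope.

(* Euclidean balls: the norm of ['rV[R]_n] in the library is the sup norm.
   In dimension 0 both balls are the one-point space and the sphere is empty. *)
Definition closed_disk (R : realType) n : set 'rV[R]_n :=
  [set x | \sum_(i < n) x ord0 i ^+ 2 <= 1].
Definition open_disk (R : realType) n : set 'rV[R]_n :=
  [set x | \sum_(i < n) x ord0 i ^+ 2 < 1].
Definition unit_sphere (R : realType) n : set 'rV[R]_n :=
  [set x | \sum_(i < n) x ord0 i ^+ 2 = 1].
Arguments closed_disk {R n}.
Arguments open_disk {R n}.
Arguments unit_sphere {R n}.

Definition homeo_on (T U : topologicalType) (D : set T) (h : T -> U) : Prop :=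
  {within D, continuous h} /\
  exists g : U -> T, {within h @` D, continuous g} /\
                     forall x, D x -> g (h x) = x.

(* Finite regular CW complexes.  Only the restriction of [char_map c] to the
   closed disk is meaningful. *)
Record cell_complex (R : realType) := CellComplex {
  space : topologicalType;
  cell : finType;
  cdim : cell -> nat;
  char_map : forall c : cell, 'rV[R]_(cdim c) -> space;
  space_hausdorff : hausdorff_space space;
  char_map_homeo : forall c, homeo_on closed_disk (@char_map c);
  open_cells_partition :
    forall x : space, exists! c, (@char_map c @` open_disk) x;
  frontier_lower_dim : forall c,
    @char_map c @` unit_sphere `<=`
      \bigcup_(d in [set d | (cdim d < cdim c)%N]) (@char_map d @` open_disk)
}.

Section CellComplex.
Context {R : realType} {X : cell_complex R}.
Implicit Types (s t : cell X) (S : {set cell X}) (i j N : nat).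

Definition open_cell s : set (space X) := @char_map R X s @` open_disk.
Definition closed_cell s : set (space X) := @char_map R X s @` closed_disk.

Definition face t s : bool := `[< closed_cell t `<=` closed_cell s >].
Definition facet t s : bool := face t s && (cdim s == (cdim t).+1).

(* A subcomplex is given by its set of cells. *)
Definition subcomplex S : Prop :=
  forall s, s \in S ->
    closed_cell s `<=` \bigcup_(t in [set t | t \in S]) open_cell t.

Definition is_filter_map N (f : cell X -> nat) : Prop :=
  [/\ forall t s, face t s -> (f t <= f s)%N,
      injective f
    & forall n, (exists s, f s = n) <-> (1 <= n <= N)%N].

Definition sublevel (f : cell X -> nat) i : {set cell X} :=
  [set s | (f s <= i)%N].

End CellComplex.

(* [quot V U] models V / (V :&: U), the quotient V / U when U is contained in V:
   it is the complement V :\: U of V :&: U in V, and [qclass V U v] is the class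
   of v \in V (see [qclass_eq0], [qclass_surj]). *)
Section Quotient.
Context {F : fieldType}.

Definition quot (vT : vectType F) (V U : {vspace vT}) : vectType F :=
  subvs_of (V :\: U)%VS.

Definition qclass (vT : vectType F) (V U : {vspace vT}) : 'Hom(vT, quot V U) :=
  (linfun (vsproj (V :\: U)%VS) \o addv_pi1 V U)%VF.

Definition qmap (vT wT : vectType F) (V U : {vspace vT}) (V' U' : {vspace wT})
    (g : 'Hom(vT, wT)) : 'Hom(quot V U, quot V' U') :=
  (qclass V' U' \o g \o linfun vsval)%VF.

Definition restr (vT wT : vectType F) (V : {vspace vT}) (W : {vspace wT})
    (g : 'Hom(vT, wT)) : 'Hom(subvs_of V, subvs_of W) :=
  (linfun (vsproj W) \o g \o linfun vsval)%VF.

Lemma qclass_rep (vT : vectType F) (V U : {vspace vT}) v :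
  v \in V -> v - vsval (qclass V U v) \in (V :&: U)%VS.
Proof.
move=> vV; rewrite /qclass comp_lfunE !lfunE /= vsprojK ?memv_pi //.
have vVU : v \in (V + U)%VS by rewrite (subvP (addvSl V U)).
rewrite memv_cap rpredB ?memv_pi1 //= -{1}(addv_pi1_pi2 vVU) addrC addKr.
exact: memv_pi2.
Qed.

Lemma qclass_eq0 (vT : vectType F) (V U : {vspace vT}) v :
  v \in V -> (qclass V U v == 0) = (v \in U).
Proof.
move=> vV; have := qclass_rep U vV; rewrite memv_cap => /andP[_ rU].
apply/eqP/idP => [q0|vU]; first by move: rU; rewrite q0 subr0.
apply: val_inj => /=; apply/eqP; rewrite -memv0 -(capv_diff V U) memv_cap.
rewrite subvsP /=; move: (rpredB vU rU).
by rewrite opprB addrC subrK.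
Qed.

Lemma qclass_surj (vT : vectType F) (V U : {vspace vT}) (x : quot V U) :
  vsval x \in V /\ qclass V U (vsval x) = x.
Proof.
have xD := subvsP x; have xV := subvP (diffvSl V U) _ xD; split=> //.
have := qclass_rep U xV; rewrite memv_cap => /andP[_ rU].
apply/esym/val_inj/eqP; rewrite -subr_eq0 -memv0 -(capv_diff V U) memv_cap rU.
by rewrite rpredB // subvsP.
Qed.

Lemma qmap_class (vT wT : vectType F) (V U : {vspace vT}) (V' U' : {vspace wT})
    (g : 'Hom(vT, wT)) v :
  (g @: V <= V')%VS -> (g @: U <= U')%VS -> v \in V ->
  qmap V U V' U' g (qclass V U v) = qclass V' U' (g v).
Proof.
move=> gV gU vV; have := qclass_rep U vV; rewrite memv_cap => /andP[rV rU].
have -> : qmap V U V' U' g (qclass V U v) =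
    qclass V' U' (g (vsval (qclass V U v))).
  by rewrite /qmap comp_lfunE comp_lfunE (lfunE vsval).
apply/esym/eqP; rewrite -subr_eq0 -linearB -linearB qclass_eq0.
  by rewrite (subvP gU) // memv_img.
by rewrite (subvP gV) // memv_img.
Qed.

Lemma restrE (vT wT : vectType F) (V : {vspace vT}) (W : {vspace wT})
    (g : 'Hom(vT, wT)) (x : subvs_of V) :
  (g @: V <= W)%VS -> vsval (restr V W g x) = g (vsval x).
Proof.
move=> gV; rewrite /restr !comp_lfunE !lfunE /= vsprojK //.
by rewrite (subvP gV) // memv_img // subvsP.
Qed.

End Quotient.

Section Homology.
Context {R : realType} {X : cell_complex R}.
Implicit Types (s t : cell X) (S : {set cell X}).

Definition chain_space : vectType 'F_2 := {ffun cell X -> ('F_2)^o}.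

Definition chain1 s : chain_space := [ffun t => (t == s)%:R].

Definition chains S : {vspace chain_space} := (\sum_(s in S) <[chain1 s]>)%VS.

(* The cellular boundary mod 2: in a regular CW complex the incidence number of t
   in s is +1 or -1 when t is a codimension 1 face of s, and 0 otherwise. *)
Definition bnd_fun (c : chain_space) : chain_space :=
  [ffun t => \sum_(s | facet t s) c s].

Lemma bnd_fun_is_linear : linear bnd_fun.
Proof.
move=> a u v; apply/ffunP => t; rewrite !ffunE scaler_sumr -big_split /=.
by apply: eq_bigr => s _; rewrite !ffunE.
Qed.
HB.instance Definition _ :=
  GRing.isLinear.Build 'F_2 chain_space chain_space _ bnd_fun bnd_fun_is_linear.

Definition bnd : 'Hom(chain_space, chain_space) := linfun bnd_fun.

Definition cycles S : {vspace chain_space} := (chains S :&: lker bnd)%VS.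
Definition boundaries S : {vspace chain_space} := (bnd @: chains S)%VS.

(* Cellular homology H_*(S) with coefficients in Z/2, all degrees at once: [bnd]
   is homogeneous, so this is the direct sum over k of H_k(S) (see
   [cycles_graded], [boundaries_graded]).  That boundaries are cycles holds for
   the face relation of a regular CW complex, but is not needed by the
   definition: [quot] only involves the boundaries that are cycles. *)
Definition homology S : vectType 'F_2 := quot (cycles S) (boundaries S).

Definition chains_of_dim k : {vspace chain_space} := chains [set s | cdim s == k].

Lemma mem_chains S (c : chain_space) :
  reflect (forall s, s \notin S -> c s = 0) (c \in chains S).
Proof.
apply: (iffP memv_sumP) => [[g gS ->] s sS|cS].
  rewrite sum_ffunE big1 // => t tS; have /vlineP[a ->] := gS t tS.
  rewrite !ffunE; case: eqP => [st|]; last by rewrite mulr0n scaler0.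
  by rewrite st tS in sS.
exists (fun s => c s *: chain1 s) => [s _|]; first by rewrite memvZ ?memv_line.
apply/ffunP => s; rewrite sum_ffunE.
case: (boolP (s \in S)) => sS.
  rewrite (bigD1 s) //= big1 ?addr0; last first.
    by move=> t /andP[_ ts]; rewrite !ffunE eq_sym (negPf ts) mulr0n scaler0.
  by rewrite !ffunE eqxx /= -[LHS]mulr1.
rewrite cS // big1 // => t tS; rewrite !ffunE; case: eqP => [st|].
  by rewrite st tS in sS.
by rewrite mulr0n scaler0.
Qed.

Lemma bndE (c : chain_space) t : bnd c t = \sum_(s | facet t s) c s.
Proof. by rewrite lfunE ffunE. Qed.

Definition dim_part k (c : chain_space) : chain_space :=
  [ffun s => if cdim s == k then c s else 0].

Lemma dim_part_sum (c : chain_space) :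
  c = \sum_(k < (\max_(s : cell X) cdim s).+1) dim_part k c.
Proof.
apply/ffunP => s; rewrite sum_ffunE.
have sk : (cdim s < (\max_(s : cell X) cdim s).+1)%N by rewrite ltnS (leq_bigmax (F := fun s : cell X => cdim s)).
rewrite (bigD1 (Ordinal sk)) //= big1 ?addr0 ?ffunE ?eqxx // => k ks.
by rewrite ffunE; case: eqP => // sk'; case/eqP: ks; apply: val_inj.
Qed.

Lemma mem_dim_part S k (c : chain_space) : c \in chains S ->
  dim_part k c \in (chains S :&: chains_of_dim k)%VS.
Proof.
move=> /mem_chains cS; rewrite memv_cap; apply/andP; split; apply/mem_chains.
  by move=> s /cS cs0; rewrite ffunE cs0; case: ifP.
by move=> s; rewrite inE ffunE => /negPf ->.
Qed.

Lemma bnd_dim_part k (c : chain_space) :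
  bnd (dim_part k.+1 c) = dim_part k (bnd c).
Proof.
apply/ffunP => t; rewrite ffunE !bndE; case: eqP => tk; last first.
  apply: big1 => s /andP[_ /eqP st]; rewrite ffunE st.
  by case: eqP => // -[].
by apply: eq_bigr => s /andP[_ /eqP st]; rewrite ffunE st tk eqxx.
Qed.

Lemma bnd_dim_part0 (c : chain_space) : bnd (dim_part 0 c) = 0.
Proof.
apply/ffunP => t; rewrite bndE ffunE; apply: big1 => s /andP[_ /eqP st].
by rewrite ffunE st.
Qed.

Lemma cycles_graded S :
  cycles S = (\sum_(k < (\max_(s : cell X) cdim s).+1)
                 (cycles S :&: chains_of_dim k))%VS.
Proof.
apply/eqP; rewrite eqEsubv; apply/andP; split; last first.
  by apply/subv_sumP => k _; exact: capvSl.
apply/subvP => c; rewrite memv_cap memv_ker => /andP[cS /eqP c0].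
rewrite (dim_part_sum c); apply: memv_sumr => -[[|k] kX] _.
  move: (mem_dim_part 0 cS); rewrite !memv_cap memv_ker => /andP[-> ->] /=.
  by rewrite bnd_dim_part0 eqxx.
move: (mem_dim_part k.+1 cS); rewrite !memv_cap memv_ker => /andP[-> ->] /=.
rewrite bnd_dim_part c0 andbT; apply/eqP/ffunP => s.
by rewrite !ffunE; case: ifP.
Qed.

Lemma boundaries_graded S :
  boundaries S = (\sum_(k < (\max_(s : cell X) cdim s).+1)
                     bnd @: (chains S :&: chains_of_dim k))%VS.
Proof.
rewrite -limg_sum; congr (_ @: _)%VS.
apply/eqP; rewrite eqEsubv; apply/andP; split; last first.
  by apply/subv_sumP => k _; exact: capvSl.
apply/subvP => c cS; rewrite (dim_part_sum c).
by apply: memv_sumr => k _; exact: mem_dim_part.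
Qed.

(* The map induced by the inclusion of S in S'. *)
Definition homology_map S S' : 'Hom(homology S, homology S') :=
  qmap (cycles S) (boundaries S) (cycles S') (boundaries S') \1%VF.

Definition hclass S : 'Hom(chain_space, homology S) :=
  qclass (cycles S) (boundaries S).

Lemma chainsS S S' : S \subset S' -> (chains S <= chains S')%VS.
Proof.
move=> SS'; apply/subvP => c /mem_chains cS; apply/mem_chains => s sS'.
by apply: cS; apply: contra sS' => /(fintype.subsetP SS').
Qed.

Lemma homology_map_class S S' (c : chain_space) :
  S \subset S' -> c \in cycles S ->
  homology_map S S' (hclass S c) = hclass S' c.
Proof.
move=> SS' cS; rewrite /homology_map /hclass qmap_class ?id_lfunE //.
  by rewrite lim1g; apply: capvS => //; exact: chainsS.
by rewrite lim1g; apply: limgS; exact: chainsS.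
Qed.

Lemma hclassP S (x : homology S) : exists2 c, c \in cycles S & hclass S c = x.
Proof. by have [xZ xE] := qclass_surj x; exists (vsval x). Qed.

Lemma homology_map_comp S S' S'' (x : homology S) :
  S \subset S' -> S' \subset S'' ->
  homology_map S' S'' (homology_map S S' x) = homology_map S S'' x.
Proof.
move=> SS' S'S''; have [c cZ <-] := hclassP x.
rewrite !homology_map_class ?(fintype.subset_trans SS') //.
by move: cZ; apply: subvP; apply: capvS => //; exact: chainsS.
Qed.

End Homology.
Arguments chain_space {R} X.

(* Persistence modules are indexed by nat; over a filtration that is constant
   from N on, only the indices 0, ..., N matter. *)
Record persistence_module (F : fieldType) := PersistenceModule {
  pm_space :> nat -> vectType F;
  pm_map : forall i, 'Hom(pm_space i, pm_space i.+1)
}.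

(* To be used for 0 < t only. *)
Definition birth (F : fieldType) (M : persistence_module F) (t : nat) : Prop :=
  \dim {: M t} = (\dim {: M t.-1} + 1)%N.
Definition death (F : fieldType) (M : persistence_module F) (t : nat) : Prop :=
  (\dim {: M t} + 1)%N = \dim {: M t.-1}.

Section Modules.
Context {R : realType} {X : cell_complex R}.
Variable f : cell X -> nat.
Implicit Types (S A B : {set cell X}) (i j : nat).

Definition level S i : {set cell X} := S :&: sublevel f i.

Definition iota_star S i : 'Hom(homology (level S i), homology (sublevel f i)) :=
  homology_map (level S i) (sublevel f i).

Definition ker_space S i : vectType 'F_2 := subvs_of (lker (iota_star S i)).

(* Induced by the inclusion of S_i in S'_j, for S contained in S' and i <= j. *)
Definition ker_map S S' i j : 'Hom(ker_space S i, ker_space S' j) :=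
  restr (lker (iota_star S i)) (lker (iota_star S' j))
    (homology_map (level S i) (level S' j)).

Lemma ker_mapE S S' i j (x : ker_space S i) :
  S \subset S' -> (i <= j)%N ->
  vsval (ker_map S S' i j x) =
    homology_map (level S i) (level S' j) (vsval x).
Proof.
move=> SS' ij; apply: restrE; apply/subvP => _ /memv_imgP[y yK ->].
have XX : sublevel f i \subset sublevel f j.
  by apply/fintype.subsetP => s; rewrite !inE => /leq_trans; apply.
move: yK; rewrite !memv_ker /iota_star => /eqP y0.
rewrite homology_map_comp ?finset.setISS ?finset.subsetIr //.
rewrite -(homology_map_comp (S' := sublevel f i)) ?finset.subsetIr //.
by rewrite y0 linear0.
Qed.

Definition Ker S : persistence_module 'F_2 :=
  @PersistenceModule _ (ker_space S) (fun i => ker_map S S i i.+1).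

Definition Phi A B i :
    'Hom((ker_space A i * ker_space B i)%type, ker_space (A :|: B) i) :=
  ((ker_map A (A :|: B) i i \o linfun fst) +
   (ker_map B (A :|: B) i i \o linfun snd))%VF.

Definition CokPhi A B : persistence_module 'F_2 :=
  @PersistenceModule _ (fun i => quot fullv (limg (Phi A B i)))
    (fun i => qmap fullv (limg (Phi A B i)) fullv (limg (Phi A B i.+1))
                (ker_map (A :|: B) (A :|: B) i i.+1)).

End Modules.

(* Main.v *)
From mathcomp Require Import all_order all_algebra zify.
Require Import Defs.
From mathcomp Require Import all_boot reals.
Import Order.TTheory GRing.Theory Num.Theory.

(** Everything reduces to counting dimensions in the chain space.  Write [Z S]
    and [D S] for the cycles and the boundaries of a set of cells [S], [S_i]
    for [level f S i] and [X_i] for the sublevel.  A class of [S_i] that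
    vanishes in [X_i] is a cycle of [S_i] that bounds in [X_i], so
      [dim Ker(S)_i = dim (Z S_i :&: D X_i) - dim (Z S_i :&: D S_i)]
    ([dim_Ker]).  From time [n] to [n.+1] a single cell s0 is added.  Facets
    precede their cofaces, so s0 is a facet of no cell of [X_n.+1]; hence a
    boundary of [X_n.+1] does not involve s0, and [Z S_n.+1] may be replaced by
    [Z S_n] in the formula.  Since [D X_n.+1] is [D X_n] plus at most one
    dimension, the two terms grow by [alpha_S] and [beta_S], both in {0, 1}
    ([dim_cycle_boundaries_step]), which say whether s0 makes a new cycle of
    [S_n] bound, in X and in S respectively ([kills]); [Ker(S)] jumps by
    [alpha_S - beta_S] ([dim_Ker_step]).

    For disjoint A and B, [Phi] is injective, so the dimension of [Cok(Phi)] is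
    that of [Ker(A :|: B)] minus those of [Ker(A)] and [Ker(B)]
    ([dim_CokPhi]); moreover [beta_(A :|: B) = beta_A + beta_B] ([killsU]).
    The betas cancel, and [Cok(Phi)] jumps by
    [alpha_(A :|: B) - alpha_A - alpha_B].

    Two implications link these bits.  Enlarging S keeps [alpha_S] true
    ([killsS]).  If [alpha_(A :|: B)] holds, then [D X_n.+1] is larger than
    [D X_n], so the boundary of s0 is not in [D X_n].  If [beta_A] holds too, some
    cycle of A is the boundary of s0 plus a chain of [A_n]; it cannot be in
    [D X_n] either, and thus [alpha_A] holds ([kills_self]).  The same goes
    for B.  The theorem is then a finite case
    analysis ([birth_death_of_jumps]). *)

(** * Dimensions of quotients and of growing intersections *)

Section LinearAlgebra.
Set Implicit Arguments.
Unset Strict Implicit.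
Local Open Scope ring_scope.
Context {F : fieldType}.

Lemma dim_subvs_of (vT : vectType F) (U : {vspace vT}) :
  \dim {: subvs_of U} = \dim U.
Proof. by rewrite dimvf. Qed.

Lemma dim_prod (vT wT : vectType F) :
  \dim {: (vT * wT)%type} = (\dim {: vT} + \dim {: wT})%N.
Proof. by rewrite !dimvf. Qed.

Lemma lfun_pairE (uT vT wT : vectType F) (g : 'Hom(vT, uT)) (h : 'Hom(wT, uT))
    x y :
  ((g \o linfun fst) + (h \o linfun snd))%VF (x, y) = g x + h y.
Proof. by rewrite add_lfunE 2!comp_lfunE (lfunE fst) (lfunE snd). Qed.

Lemma dim_quot (vT : vectType F) (V U : {vspace vT}) :
  (\dim (V :&: U) + \dim {: quot V U})%N = \dim V.
Proof. by rewrite dim_subvs_of dimv_cap_compl. Qed.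

(** The first isomorphism theorem for [V / (V :&: U) -> V' / (V' :&: U')]: its
    kernel is [(V :&: U') / (V :&: U)].  The additive form avoids truncated
    subtraction. *)
Lemma dim_lker_qmap (vT : vectType F) (V U V' U' : {vspace vT}) :
  (V <= V')%VS -> (U <= U')%VS ->
  (\dim (lker (qmap V U V' U' \1%VF)) + \dim (V :&: U))%N =
    \dim (V :&: U').
Proof.
move=> VV' UU'.
have classE v : v \in V -> qmap V U V' U' \1%VF (qclass V U v) = qclass V' U' v.
  by move=> vV; rewrite qmap_class ?lim1g ?id_lfunE.
(* the class map restricted to V :&: U' is onto the kernel *)
have -> : lker (qmap V U V' U' \1%VF) = (qclass V U @: (V :&: U'))%VS.
  apply/vspaceP => x; apply/idP/idP => [|/memv_imgP[v]].
    have [xV xE] := qclass_surj x.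
    rewrite memv_ker -{1}xE classE // qclass_eq0 ?(subvP VV') // => xU'.
    by rewrite -xE memv_img // memv_cap xV.
  rewrite memv_cap => /andP[vV vU'] ->.
  by rewrite memv_ker classE // qclass_eq0 // (subvP VV').
rewrite -[RHS](limg_ker_dim (qclass V U)) addnC; congr (\dim _ + _)%N.
apply/vspaceP => v; rewrite !memv_cap memv_ker.
case: (boolP (v \in V)) => //= vV; rewrite qclass_eq0 //.
by case: (boolP (v \in U)) => [/(subvP UU') ->|_]; rewrite ?andbF.
Qed.

(** Intersecting with [Z] cannot enlarge the codimension of [U] in [U'], which
    is at most one.  The boolean summand makes the jump usable in arithmetic. *)
Lemma dim_cap_step (vT : vectType F) (Z U U' : {vspace vT}) v :
  (U <= U')%VS -> (U' <= U + <[v]>)%VS ->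
  \dim (Z :&: U') = (\dim (Z :&: U) + ~~ (Z :&: U' <= U)%VS)%N.
Proof.
move=> UU' U'v; have sZ : (Z :&: U <= Z :&: U')%VS by rewrite capvS.
case: (boolP (Z :&: U' <= U)%VS) => [le|nle] /=.
  rewrite addn0; congr (\dim _); apply/eqP; rewrite eqEsubv sZ andbT.
  by rewrite subv_cap capvSl.
apply/eqP; rewrite eqn_leq addn1; apply/andP; split; last first.
  rewrite ltn_neqAle dimvS // andbT; apply: contra nle => /eqP eqd.
  have /eqP <- : (Z :&: U == Z :&: U')%VS by rewrite eqEdim sZ eqd /=.
  exact: capvSr.
have dU : (\dim (U + (Z :&: U')) <= (\dim U).+1)%N.
  have := dim_vline v; have := dimv_add_leqif U <[v]>%VS => -[lev _] dv.
  apply: (leq_trans (n := \dim (U + <[v]>))).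
    by apply: dimvS; rewrite subv_add addvSl (subv_trans (capvSr _ _)).
  by apply: leq_trans lev _; rewrite dv -addn1 leq_add2l leq_b1.
have := dimv_sum_cap U (Z :&: U')%VS.
have -> : (U :&: (Z :&: U') = Z :&: U)%VS.
  by rewrite capvA [(U :&: Z)%VS]capvC -capvA (capv_idPl UU').
by move: dU; lia.
Qed.

End LinearAlgebra.

(** * Chains, cycles and boundaries of disjoint subcomplexes *)

Section Chains.
Set Implicit Arguments.
Unset Strict Implicit.
Local Open Scope ring_scope.
Context {R : realType} {X : cell_complex R}.
Implicit Types (s t : cell X) (S T A B : {set cell X}).

Definition facet_closed S : Prop := forall t s, facet t s -> s \in S -> t \in S.

(** The centre of a facet t of s lies in the closed cell of s, hence in an open
    cell of S, and this open cell can only be that of t. *)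
Lemma subcomplex_facet_closed S : subcomplex S -> facet_closed S.
Proof.
move=> subS t s /andP[/boolp.asboolP ts _] sS.
have D0 : @open_disk R (cdim t) 0.
  rewrite /open_disk /classical_sets.mkset big1 ?ltr01 // => i _.
  by rewrite mxE expr0n.
have ct : open_cell t (@char_map _ _ t 0) by exists 0.
have cct : closed_cell t (@char_map _ _ t 0) by exists 0 => //; exact: ltW.
have [t' t'S ct'] := subS s sS _ (ts _ cct).
have [u [_ uP]] := open_cells_partition (@char_map _ _ t 0).
by rewrite -(uP _ ct) (uP _ ct').
Qed.

Lemma facet_closedU A B :
  facet_closed A -> facet_closed B -> facet_closed (A :|: B).
Proof.
by move=> fA fB t s ts; rewrite !inE => /orP[/(fA _ _ ts)|/(fB _ _ ts)] ->;
  rewrite ?orbT.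
Qed.

(** The second set [T] lets this serve both for closed sets ([T = S]) and for a
    boundary that drops one filtration step. *)
Lemma boundaries_sub_chains S T :
  (forall t s, facet t s -> s \in S -> t \in T) ->
  (boundaries S <= chains T)%VS.
Proof.
move=> ST; apply/subvP => _ /memv_imgP[c /mem_chains cS ->].
apply/mem_chains => t tT; rewrite bndE big1 // => s ts; apply: cS.
by apply: contra tT; exact: ST.
Qed.

Lemma boundariesS S T : S \subset T -> (boundaries S <= boundaries T)%VS.
Proof. by move=> ST; rewrite limgS ?chainsS. Qed.

Lemma cyclesS S T : S \subset T -> (cycles S <= cycles T)%VS.
Proof. by move=> ST; rewrite capvS ?chainsS. Qed.

Lemma chainsU A B : chains (A :|: B) = (chains A + chains B)%VS.
Proof.
apply/eqP; rewrite eqEsubv subv_add !chainsS ?subsetUl ?subsetUr // !andbT.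
rewrite {1}/chains; apply/subv_sumP => s; rewrite -memvE inE => /orP[] sS.
  apply: (subvP (addvSl _ _)).
  by rewrite /chains (bigD1 s) //= (subvP (addvSl _ _)) ?memv_line.
apply: (subvP (addvSr _ _)).
by rewrite /chains (bigD1 s) //= (subvP (addvSl _ _)) ?memv_line.
Qed.

Lemma boundariesU A B :
  boundaries (A :|: B) = (boundaries A + boundaries B)%VS.
Proof. by rewrite /boundaries chainsU limgD. Qed.

Lemma mem_chainsI S T (c : chain_space X) :
  c \in chains S -> c \in chains T -> c \in chains (S :&: T).
Proof.
move=> /mem_chains cS /mem_chains cT; apply/mem_chains => s.
by rewrite inE negb_and => /orP[/cS|/cT].
Qed.

Lemma disjoint_chains A B : [disjoint A & B] -> (chains A :&: chains B = 0)%VS.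
Proof.
move=> AB; apply/eqP; rewrite -subv0; apply/subvP => c; rewrite memv_cap.
move=> /andP[cA cB]; move: (mem_chainsI cA cB).
by rewrite (disjoint_setI0 AB) /chains big_set0.
Qed.

Lemma disjoint_chains_eq A B (a a' b b' : chain_space X) :
  [disjoint A & B] -> a \in chains A -> a' \in chains A ->
  b \in chains B -> b' \in chains B -> a + b = a' + b' -> a = a' /\ b = b'.
Proof.
move=> AB aA a'A bB b'B e; suff aE : a = a'.
  by split=> //; move: e; rewrite aE => /addrI.
have e2 : a - a' = b' - b.
  by apply/eqP; rewrite subr_eq addrAC [b' + _]addrC -e addrK.
apply/eqP; rewrite -subr_eq0 -memv0 -(disjoint_chains AB) memv_cap.
by rewrite rpredB //= e2 rpredB.
Qed.

(** This is what makes homology additive: no cell of A can help a chain of B to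
    bound. *)
Lemma mem_boundariesU A B (a b : chain_space X) :
  facet_closed A -> facet_closed B -> [disjoint A & B] ->
  a \in chains A -> b \in chains B -> a + b \in boundaries (A :|: B) ->
  a \in boundaries A /\ b \in boundaries B.
Proof.
move=> fA fB AB aA bB; rewrite boundariesU => /memv_addP[p pA [q qB e]].
have [-> ->] := disjoint_chains_eq AB aA (subvP (boundaries_sub_chains fA) _ pA)
  bB (subvP (boundaries_sub_chains fB) _ qB) e.
by [].
Qed.

Lemma dim_cycle_boundariesU A B :
  facet_closed A -> facet_closed B -> [disjoint A & B] ->
  \dim (cycles (A :|: B) :&: boundaries (A :|: B)) =
    (\dim (cycles A :&: boundaries A) + \dim (cycles B :&: boundaries B))%N.
Proof.
move=> fA fB AB.
have bA := subvP (boundaries_sub_chains fA).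
have bB := subvP (boundaries_sub_chains fB).
rewrite -dimv_disjoint_sum; last first.
  apply/eqP; rewrite -subv0 -(disjoint_chains AB).
  by apply: capvS; apply: (subv_trans (capvSl _ _)); exact: capvSl.
congr (\dim _); apply/eqP; rewrite eqEsubv subv_add; apply/andP; split; last first.
  by apply/andP; split; apply: capvS;
    rewrite ?cyclesS ?boundariesS ?subsetUl ?subsetUr.
apply/subvP => z; rewrite !memv_cap memv_ker => /andP[/andP[_ /eqP z0]].
rewrite boundariesU => /memv_addP[p pA [q qB e]].
(* the boundaries of p and q add up to 0 but live on disjoint cells *)
have [] := @disjoint_chains_eq _ _ (bnd p) 0 (bnd q) 0 AB.
- by rewrite bA // memv_img ?bA.
- exact: mem0v.
- by rewrite bB // memv_img ?bB.
- exact: mem0v.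
- by rewrite -linearD -e /= z0 addr0.
move=> p0 q0; rewrite e memv_add // memv_cap.
  by rewrite pA andbT memv_cap memv_ker p0 eqxx bA.
by rewrite qB andbT memv_cap memv_ker q0 eqxx bB.
Qed.

End Chains.

(** * Dimensions of the kernel and cokernel modules *)

Section Modules.
Set Implicit Arguments.
Unset Strict Implicit.
Local Open Scope ring_scope.
Context {R : realType} {X : cell_complex R}.
Variable f : cell X -> nat.
Implicit Types (S T A B : {set cell X}) (i j : nat).

(** The kernel at [i] consists of the cycles of [S_i] that bound in [X_i],
    modulo those that bound in [S_i]. *)
Lemma dim_Ker S i :
  (\dim {: Ker f S i} +
     \dim (cycles (level f S i) :&: boundaries (level f S i)))%N =
  \dim (cycles (level f S i) :&: boundaries (sublevel f i)).
Proof.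
have le : level f S i \subset sublevel f i by rewrite subsetIr.
by rewrite dim_subvs_of dim_lker_qmap ?cyclesS ?boundariesS.
Qed.

Lemma levelU A B i : level f (A :|: B) i = level f A i :|: level f B i.
Proof. by rewrite /level setIUl. Qed.

Lemma disjoint_level A B i :
  [disjoint A & B] -> [disjoint level f A i & level f B i].
Proof.
move=> AB; apply: disjointWl (subsetIl _ _) _.
exact: disjointWr (subsetIl _ _) AB.
Qed.

Lemma PhiE A B i (x : ker_space f A i) (y : ker_space f B i) :
  vsval (Phi f A B i (x, y)) =
    homology_map (level f A i) (level f (A :|: B) i) (vsval x) +
    homology_map (level f B i) (level f (A :|: B) i) (vsval y).
Proof.
rewrite /Phi lfun_pairE.
by rewrite -!ker_mapE ?subsetUl ?subsetUr //; exact: linearD.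
Qed.

(** Cycles c of A and d of B whose sum bounds in the disjoint union bound
    separately, so [Phi] is injective. *)
Lemma lker_Phi A B i :
  facet_closed (level f A i) -> facet_closed (level f B i) -> [disjoint A & B] ->
  lker (Phi f A B i) = 0%VS.
Proof.
move=> fA fB AB; apply/eqP; rewrite -subv0; apply/subvP => -[x y].
have dAB := disjoint_level i AB.
rewrite memv_ker memv0 => /eqP /(congr1 vsval); rewrite PhiE.
have [c cZ cE] := hclassP (vsval x); have [d dZ dE] := hclassP (vsval y).
have lA : level f A i \subset level f (A :|: B) i by rewrite levelU subsetUl.
have lB : level f B i \subset level f (A :|: B) i by rewrite levelU subsetUr.
rewrite -cE -dE !homology_map_class // -linearD /= => /eqP.
rewrite qclass_eq0; last first.
  by apply: rpredD; [move: cZ | move: dZ]; apply/subvP/cyclesS.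
rewrite levelU => cd.
have [cB dB] := mem_boundariesU fA fB dAB (subvP (capvSl _ _) _ cZ)
  (subvP (capvSl _ _) _ dZ) cd.
have x0 : x = 0 by apply: val_inj; apply/eqP; rewrite /= -cE qclass_eq0.
have y0 : y = 0 by apply: val_inj; apply/eqP; rewrite /= -dE qclass_eq0.
by rewrite x0 y0.
Qed.

Lemma dim_CokPhi A B i :
  facet_closed (level f A i) -> facet_closed (level f B i) -> [disjoint A & B] ->
  (\dim {: CokPhi f A B i} + (\dim {: Ker f A i} + \dim {: Ker f B i}))%N =
  \dim {: Ker f (A :|: B) i}.
Proof.
move=> fA fB AB; rewrite -(dim_quot fullv (limg (Phi f A B i))) addnC.
congr (_ + _)%N; rewrite capfv -dim_prod.
by rewrite -(limg_ker_dim (Phi f A B i)) lker_Phi // capv0 dimv0.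
Qed.

End Modules.

(** * Adding one cell *)

Section OneStep.
Set Implicit Arguments.
Unset Strict Implicit.
Local Open Scope ring_scope.
Context {R : realType} {X : cell_complex R}.
Variables (N : nat) (f : cell X -> nat).
Hypothesis fX : is_filter_map N f.
Implicit Types (S T A B : {set cell X}).

Lemma facet_lt t s : facet t s -> (f t < f s)%N.
Proof.
have [mono inj _] := fX; move=> /andP[ts /eqP d].
rewrite ltn_neqAle mono // andbT; apply/eqP => /inj e.
by move: d; rewrite e; lia.
Qed.

Lemma facet_closed_level S i : facet_closed S -> facet_closed (level f S i).
Proof.
move=> fS t s ts; rewrite !inE => /andP[/(fS _ _ ts) -> /=].
by have := facet_lt ts; lia.
Qed.

Variable n : nat.
Hypothesis nN : (n < N)%N.

Lemma new_cell : exists s0, forall s, (f s <= n.+1)%N = (s == s0) || (f s <= n)%N.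
Proof.
have [_ inj im] := fX; have [|s0 fs0] := (im n.+1).2; first by lia.
exists s0 => s; rewrite leq_eqVlt ltnS -fs0; congr (_ || _).
by apply/eqP/eqP => [/inj|->].
Qed.

(** One predicate for both kinds of jump: [alpha_S] is [kills S setT] and
    [beta_S] is [kills S S]. *)
Definition kills S T : bool :=
  ~~ (cycles (level f S n) :&: boundaries (level f T n.+1)
        <= boundaries (level f T n))%VS.

Lemma level_n S : level f S n \subset level f S n.+1.
Proof. by apply/subsetP => s; rewrite !inE => /andP[-> /=]; lia. Qed.

(** A boundary at time [n.+1] never involves the new cell, which is a facet of
    nothing present so far; so the cycles of time [n] suffice. *)
Lemma cycle_boundaries_step S T : S \subset T -> facet_closed T ->
  (cycles (level f S n.+1) :&: boundaries (level f T n.+1) =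
   cycles (level f S n) :&: boundaries (level f T n.+1))%VS.
Proof.
move=> ST fT; apply/eqP; rewrite eqEsubv andbC capvS ?cyclesS ?level_n //=.
apply/subvP => c; rewrite !memv_cap => /andP[/andP[cS ->] cb].
rewrite cb !andbT.
have /subvP/(_ _ cb) cT : (boundaries (level f T n.+1) <= chains (level f T n))%VS.
  apply: boundaries_sub_chains => t s ts; rewrite !inE => /andP[/(fT _ _ ts) -> /=].
  by have := facet_lt ts; lia.
apply: (subvP (chainsS _) _ (mem_chainsI cS cT)).
by apply/subsetP => s; rewrite !inE => /andP[/andP[-> _] /andP[]].
Qed.

Lemma chains_new_cell s0 S :
  (forall s, (f s <= n.+1)%N = (s == s0) || (f s <= n)%N) ->
  (chains (level f S n.+1) <= chains (level f S n) + <[chain1 s0]>)%VS.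
Proof.
move=> new; have -> : <[chain1 s0]>%VS = chains [set s0] by rewrite /chains big_set1.
rewrite -chainsU; apply: chainsS; apply/subsetP => s.
by rewrite !inE new => /andP[-> /orP[->|->]]; rewrite ?orbT.
Qed.

Lemma dim_cycle_boundaries_step S T : S \subset T -> facet_closed T ->
  \dim (cycles (level f S n.+1) :&: boundaries (level f T n.+1)) =
  (\dim (cycles (level f S n) :&: boundaries (level f T n)) + kills S T)%N.
Proof.
move=> ST fT; rewrite cycle_boundaries_step //.
have [s0 new] := new_cell.
apply: (@dim_cap_step _ _ _ _ _ (bnd (chain1 s0))).
  by rewrite boundariesS ?level_n.
by rewrite -limg_line -limgD limgS ?chains_new_cell.
Qed.

Lemma killsS S S' T : S \subset S' -> kills S T -> kills S' T.
Proof.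
move=> SS'; apply: contra => /(subv_trans _); apply.
by rewrite capvS ?cyclesS // setSI.
Qed.

(** If the new cell makes some cycle of [S'] bound in X, then its own boundary
    was not a boundary of [X_n].  A cycle z of S that the new cell makes bound in
    S is the boundary of the new cell plus a boundary of [S_n], so z did not
    bound in [X_n] either. *)
Lemma kills_self S S' :
  kills S S -> kills S' setT -> kills S setT.
Proof.
have [s0 new] := new_cell.
set Xm := boundaries (level f setT n).
case: (boolP (bnd (chain1 s0) \in Xm)) => [s0X _|s0X].
  rewrite {1}/kills => /negP[]; apply: (subv_trans (capvSr _ _)).
  apply: (subv_trans (limgS _ (chains_new_cell _ new))).
  by rewrite limgD limg_line subv_add subvv -memvE.
move=> /subvPn[z zSS zS] _.
move: zSS; rewrite memv_cap => /andP[zZ zb].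
apply/subvPn; exists z.
  by rewrite memv_cap zZ (subvP (boundariesS _) _ zb) // setSI ?subsetT.
apply: contra s0X => zX.
have /memv_imgP[c cS zE] := zb.
have /memv_addP[c' c'S [_ /vlineP[a ->] cE]] := subvP (chains_new_cell _ new) _ cS.
(* c involves the new cell, as z is not a boundary of S at time n *)
have a0 : a != 0.
  apply: contra zS => /eqP a0; rewrite zE cE a0 scale0r addr0; exact: memv_img.
have := zX; rewrite zE cE linearD linearZ /= rpredDl; last first.
  by rewrite (subvP (boundariesS _) _ (memv_img _ c'S)) // setSI ?subsetT.
by rewrite rpredZeq (negPf a0).
Qed.

Lemma dim_Ker_step S : facet_closed S ->
  (\dim {: Ker f S n.+1} + kills S S)%N = (\dim {: Ker f S n} + kills S setT)%N.
Proof.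
move=> fS; have fT : facet_closed [set: cell X] by move=> t s _ _; rewrite inE.
have := dim_Ker f S n; have := dim_Ker f S n.+1.
have XE i : sublevel f i = level f setT i by rewrite /level setTI.
rewrite !XE !dim_cycle_boundaries_step ?subsetT //; lia.
Qed.

(** The dimension of the space of cycles that bound is additive over A and B
    both before and after the new cell arrives, hence so is its growth. *)
Lemma killsU A B : facet_closed A -> facet_closed B -> [disjoint A & B] ->
  (kills (A :|: B) (A :|: B) : nat) = (kills A A + kills B B)%N.
Proof.
move=> fA fB AB; have fAB := facet_closedU fA fB.
have dAB i := disjoint_level f i AB.
have split i := dim_cycle_boundariesU (facet_closed_level fA)
  (facet_closed_level fB) (dAB i).
have := split n.+1; rewrite -levelU !dim_cycle_boundaries_step //.
by rewrite levelU split; lia.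
Qed.

End OneStep.

(** * Births and deaths *)

(** The arithmetic of the theorem: [aA], [aB], [aAB] are the alphas and [bA],
    [bB], [bAB] the betas.  When [aA] and [aB] both hold, the cokernel loses a
    dimension; this is case (a) if [bA] and [bB] are false, and case (b)
    otherwise, because a true beta cancels one of the two births and the birth
    in the union. *)
Lemma birth_death_of_jumps (aA aB aAB bA bB bAB : bool)
    (kA kA' kB kB' kAB kAB' c c' : nat) :
  kA' + bA = kA + aA -> kB' + bB = kB + aB -> kAB' + bAB = kAB + aAB ->
  c + (kA + kB) = kAB -> c' + (kA' + kB') = kAB' ->
  bAB = bA + bB :> nat -> (aA -> aAB) -> (aB -> aAB) ->
  (bA -> aAB -> aA) -> (bB -> aAB -> aB) ->
  [/\ c' = c + 1 <-> [/\ kAB' = kAB + 1, ~ kA' = kA + 1 & ~ kB' = kB + 1],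
      c' + 1 = c <->
        (kA' = kA + 1 /\ kB' = kB + 1) \/
        ((kA' = kA + 1 /\ ~ kB' = kB + 1 \/ ~ kA' = kA + 1 /\ kB' = kB + 1) /\
         ~ kAB' = kAB + 1)
    & kA' = kA + 1 /\ kB' = kB + 1 -> kAB' = kAB + 1].
Proof.
by case: aA aB aAB bA bB bAB => [] [] [] [] [] [] /= *;
  (split; [split=> [?|[*]] | |]); do ?split; lia.
Qed.

Theorem theorem3p1 (R : realType) (X : cell_complex R) (N : nat)
    (f : cell X -> nat) (A B : {set cell X}) (t : nat) :
  is_filter_map N f ->
  subcomplex A -> subcomplex B ->
  A != set0 -> B != set0 -> [disjoint A & B] ->
  (1 <= t <= N)%N ->
  [/\ birth (CokPhi f A B) t <->
        [/\ birth (Ker f (A :|: B)) t,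
            ~ birth (Ker f A) t & ~ birth (Ker f B) t],
      death (CokPhi f A B) t <->
        (birth (Ker f A) t /\ birth (Ker f B) t) \/
        ((birth (Ker f A) t /\ ~ birth (Ker f B) t \/
          ~ birth (Ker f A) t /\ birth (Ker f B) t) /\
         ~ birth (Ker f (A :|: B)) t)
    & birth (Ker f A) t /\ birth (Ker f B) t -> birth (Ker f (A :|: B)) t].
Proof.
move=> fX /subcomplex_facet_closed fA /subcomplex_facet_closed fB _ _ AB.
case: t => // n /= nN.
have stepA := dim_Ker_step fX nN fA.
have stepB := dim_Ker_step fX nN fB.
have stepAB := dim_Ker_step fX nN (facet_closedU fA fB).
have cok i := @dim_CokPhi _ _ f A B i (facet_closed_level fX fA)
  (facet_closed_level fX fB) AB.
have kAB := killsU fX nN fA fB AB.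
have kA := @killsS _ _ f n A (A :|: B) setT (subsetUl A B).
have kB := @killsS _ _ f n B (A :|: B) setT (subsetUr A B).
have sA : kills f n A A -> kills f n (A :|: B) setT -> kills f n A setT.
  exact: (kills_self fX nN).
have sB : kills f n B B -> kills f n (A :|: B) setT -> kills f n B setT.
  exact: (kills_self fX nN).
exact: (birth_death_of_jumps stepA stepB stepAB (cok n) (cok n.+1) kAB kA kB sA sB).
Qed.
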